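(* Let $p>0$ and $\sigma>0$, let $N>1$ be an integer, and let $s\in\mathbb{N}$ with $1\le s<N/2$. Then $$\left\{\mathbf{v}\in\mathbb{R}^N:\lVert \mathbf{v}_S\rVert_1<\lVert \mathbf{v}_{S^c}\rVert_1\ \ \forall\, S\subset [N]\text{ with }|S|\le s\right\}\subset \left\{\mathbf{v}\in\mathbb{R}^N: J_{p,\sigma}(\mathbf{v}_S)<J_{p,\sigma}(\mathbf{v}_{S^c})\ \ \forall\, S\subset [N]\text{ with }|S|\le s\right\}.$$ Consequently, the generalized null space property relative to $J_{p,\sigma}$ is less demanding than the null space property for $\ell_1$-minimization: every matrix $A\in\mathbb{R}^{m\times N}$ that satisfies the null space property of order $s$ also satisfies the generalized null space property of order $s$ relative to $J_{p,\sigma}$.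
   Context: For $p>0$, $\sigma>0$ and $\mathbf{x}\in\mathbb{R}^N$, define $J_{p,\sigma}(\mathbf{x})=\sum_{j=1}^N \Phi_{p,\sigma}(|x_j|)$, where $\Phi_{p,\sigma}(x)=\int_0^x e^{-(\tau/\sigma)^p}\,d\tau$ for $x\ge 0$. $[N]=\{1,\dots,N\}$, $S^c=[N]\setminus S$, and $\mathbf{v}_S\in\mathbb{R}^N$ is the vector that coincides with $\mathbf{v}$ on the indices in $S$ and is zero outside $S$. $\mathrm{Ker}(A)=\{\mathbf{x}\in\mathbb{R}^N: A\mathbf{x}=\mathbf{0}\}$. A matrix $A\in\mathbb{R}^{m\times N}$ satisfies the null space property of order $s$ (for $\ell_1$-minimization) if $\lVert \mathbf{v}_S\rVert_1<\lVert\mathbf{v}_{S^c}\rVert_1$ for all $\mathbf{v}\in\mathrm{Ker}(A)\setminus\{\mathbf{0}\}$ and all $S\subset[N]$ with $|S|\le s$. It satisfies the generalized null space property of order $s$ relative to $J_{p,\sigma}$ if $J_{p,\sigma}(\mathbf{v}_S)<J_{p,\sigma}(\mathbf{v}_{S^c})$ for all $\mathbf{v}\in\mathrm{Ker}(A)\setminus\{\mathbf{0}\}$ and all $S\subset[N]$ with $|S|\le s$. *)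

(* Defs.v *)
From mathcomp Require Export all_boot all_order all_algebra.
From mathcomp Require Export all_classical all_reals all_analysis.

Set Implicit Arguments.
Unset Strict Implicit.
Unset Printing Implicit Defensive.

Import Order.TTheory GRing.Theory Num.Theory.
Import numFieldNormedType.Exports.

Local Open Scope classical_set_scope.
Local Open Scope ring_scope.

(* Only meant for 0 <= x: for x < 0 the interval `[0, x] is empty, so the
   value is 0 instead of the oriented integral. *)
Definition Phi (R : realType) (p sigma x : R) : R :=
  \int[lebesgue_measure]_(tau in `[0, x]) expR (- ((tau / sigma) `^ p)).

Definition J (R : realType) (N : nat) (p sigma : R) (x : 'cV[R]_N) : R :=
  \sum_(j < N) Phi p sigma `|x j 0|.

(* The library norm `|v| on matrices is the sup norm, hence this one. *)
Definition l1norm (R : realType) (N : nat) (v : 'cV[R]_N) : R :=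
  \sum_(j < N) `|v j 0|.

Definition restr (R : realType) (N : nat) (S : {set 'I_N}) (v : 'cV[R]_N) :
    'cV[R]_N :=
  \col_(j < N) (if j \in S then v j 0 else 0).

(* The kernel for the action on column vectors; the library's kermx is the
   row kernel. *)
Definition Ker (R : realType) (m N : nat) (A : 'M[R]_(m, N)) : set 'cV[R]_N :=
  [set x | A *m x = 0].

Definition null_space_property (R : realType) (m N : nat) (s : nat)
    (A : 'M[R]_(m, N)) : Prop :=
  forall v : 'cV[R]_N, (Ker A `\ 0) v ->
  forall S : {set 'I_N}, (#|S| <= s)%N ->
    l1norm (restr S v) < l1norm (restr (~: S) v).

Definition generalized_null_space_property (R : realType) (p sigma : R)
    (m N : nat) (s : nat) (A : 'M[R]_(m, N)) : Prop :=
  forall v : 'cV[R]_N, (Ker A `\ 0) v ->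
  forall S : {set 'I_N}, (#|S| <= s)%N ->
    J p sigma (restr S v) < J p sigma (restr (~: S) v).

(* Main.v *)
(* The function Phi vanishes at 0, is strictly increasing, and Phi x / x is
   nonincreasing since its density is. Among the sets of cardinality at most s
   take T maximizing the sum of Phi |v_i|; it is enough to treat T. By exchange
   every |v_i| with i in T is at least M, the maximum of the |v_j| off T, and M
   is positive because of the l1 inequality for T. Then Phi |v_i| is at most
   (Phi M / M) |v_i| on T and at least that off T, so that the l1 inequality
   scaled by Phi M / M sits between the two sums of Phi. *)
Require Import Defs.
From mathcomp Require Import measurable_realfun lra.
Set Implicit Arguments.
Unset Strict Implicit.
Unset Printing Implicit Defensive.
Import Order.TTheory GRing.Theory Num.Theory.
Import numFieldNormedType.Exports.
Local Open Scope classical_set_scope.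
Local Open Scope ring_scope.

Definition Phi_density (R : realType) (p sigma tau : R) : R :=
  expR (- ((tau / sigma) `^ p)).

Lemma Phi_density_antitone (R : realType) (p sigma x y : R) :
  0 < p -> 0 < sigma -> 0 <= x -> x <= y ->
  Phi_density p sigma y <= Phi_density p sigma x.
Proof.
move=> p0 s0 x0 xy; rewrite ler_expR lerN2.
have si0 : 0 <= sigma^-1 by rewrite invr_ge0 ltW.
by apply: ge0_ler_powR; rewrite ?nnegrE ?ler_wpM2r ?mulr_ge0 ?(ltW p0)
  ?(le_trans x0 xy).
Qed.

Lemma Phi_density_integrable (R : realType) (p sigma a b : R) :
  lebesgue_measure.-integrable `[a, b] (EFin \o Phi_density p sigma).
Proof.
apply: measurable_bounded_integrable => //.
- exact/compact_finite_measure/segment_compact.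
- apply: measurable_funTS; apply: measurableT_comp => //.
  apply: measurableT_comp => //.
  by apply: (measurableT_comp (measurable_powR _)); apply: mulrr_measurable.
(* Real powers are nonnegative, so the exponent is nonpositive and the density is at most [1]. *)
- exists 1; split; [exact: num_real|move=> M M1 t _].
  rewrite /= ger0_norm ?expR_ge0// (le_trans _ (ltW M1))//.
  by rewrite -expR0 ler_expR oppr_le0 powR_ge0.
Qed.

Lemma Phi0 (R : realType) (p sigma : R) : Phi p sigma 0 = 0.
Proof. by rewrite /Phi set_itv1 Rintegral_set1. Qed.

(** On []x, y]] the antitone density lies between its values at [y] and [x]; integrating these two
    constants gives both bounds. *)
Lemma Phi_increment_bounds (R : realType) (p sigma x y : R) :
  0 < p -> 0 < sigma -> 0 <= x -> x <= y ->
  Phi_density p sigma y * (y - x) <= Phi p sigma y - Phi p sigma x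
    <= Phi_density p sigma x * (y - x).
Proof.
move=> p0 s0 x0 xy.
have intxy : lebesgue_measure.-integrable `]x, y] (EFin \o Phi_density p sigma).
  apply: integrableS (Phi_density_integrable p sigma x y) => //.
  exact: subset_itv_oc_cc.
have intcst (r : R) : lebesgue_measure.-integrable `]x, y] (EFin \o (fun=> r)).
  apply: integrableS (_ : lebesgue_measure.-integrable `[x, y] _) => //.
    exact: subset_itv_oc_cc.
  apply: continuous_compact_integrable; first exact: segment_compact.
  exact/continuous_subspaceT/cst_continuous.
have cstE (r : R) : r * (y - x) = \int[lebesgue_measure]_(tau in `]x, y]) r.
  rewrite Rintegral_cst//= lebesgue_measure_itv/= lte_fin.
  (* The interval is empty only for [x = y], where both sides vanish. *)
  by case: ltP => [//|yx]; rewrite (@le_anti _ _ x y) ?xy// subrr.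
rewrite /Phi Rintegral_itvB ?bnd_simp//; last exact: Phi_density_integrable.
by rewrite !cstE; apply/andP; split; apply: le_Rintegral => // t /=;
  rewrite in_itv/= => /andP[xt ty]; apply: Phi_density_antitone => //;
  rewrite ?(le_trans x0) ?(ltW xt).
Qed.

Lemma ltr_Phi (R : realType) (p sigma x y : R) :
  0 < p -> 0 < sigma -> 0 <= x -> x < y -> Phi p sigma x < Phi p sigma y.
Proof.
move=> p0 s0 x0 xy; rewrite -subr_gt0.
have /andP[+ _] := Phi_increment_bounds p0 s0 x0 (ltW xy).
by apply: lt_le_trans; rewrite mulr_gt0 ?expR_gt0 ?subr_gt0.
Qed.

(** A division-free form of the monotonicity of [Phi x / x], valid at [x = 0] too. With [d] the
    density at [x], [x * (Phi y - Phi x) <= x * d * (y - x) <= Phi x * (y - x)]. *)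
Lemma Phi_star_shaped (R : realType) (p sigma x y : R) :
  0 < p -> 0 < sigma -> 0 <= x -> x <= y ->
  x * Phi p sigma y <= y * Phi p sigma x.
Proof.
move=> p0 s0 x0 xy.
have /andP[_ upper] := Phi_increment_bounds p0 s0 x0 xy.
have /andP[lower _] := Phi_increment_bounds p0 s0 (lexx 0) x0.
rewrite Phi0 !subr0 in lower.
have yx0 : 0 <= y - x by rewrite subr_ge0.
have := ler_wpM2l x0 upper; have := ler_wpM2r yx0 lower.
lra.
Qed.

(** Serves both functionals: [f = id] for the l1 norm, [f = Phi p sigma] for [J]. *)
Lemma sum_restr (R : realType) (N : nat) (f : R -> R) (S : {set 'I_N})
    (v : 'cV[R]_N) : f 0 = 0 ->
  \sum_(j < N) f `|restr S v j 0| = \sum_(j in S) f `|v j 0|.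
Proof.
move=> f0; rewrite [RHS]big_mkcond/=; apply: eq_bigr => j _.
by rewrite mxE; case: ifP => // _; rewrite normr0.
Qed.

(** The line through the origin and [(M, F M)] lies above [F] beyond [M] and below it on
    [[0, M]]. *)
Lemma threshold_sum_lt (R : realFieldType) (I : finType) (F : R -> R)
    (a : I -> R) (T : {set I}) (M : R) :
  0 < M -> 0 < F M ->
  (forall x y, 0 <= x -> x <= y -> x * F y <= y * F x) ->
  (forall i, 0 <= a i) -> {in T, forall i, M <= a i} ->
  {in ~: T, forall j, a j <= M} ->
  \sum_(i in T) a i < \sum_(j in ~: T) a j ->
  \sum_(i in T) F (a i) < \sum_(j in ~: T) F (a j).
Proof.
move=> M0 FM0 starF a0 Ma aM alt.
rewrite -(ltr_pM2l M0) !mulr_sumr.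
apply: (@le_lt_trans _ _ (F M * \sum_(i in T) a i)).
  rewrite mulr_sumr; apply: ler_sum => i iT.
  by rewrite [leRHS]mulrC starF ?Ma ?(ltW M0).
apply: (@lt_le_trans _ _ (F M * \sum_(j in ~: T) a j)).
  by rewrite ltr_pM2l.
rewrite mulr_sumr; apply: ler_sum => j jT.
by rewrite mulrC starF ?aM.
Qed.

Lemma sum_lt_setC_star_shaped (R : realFieldType) (I : finType) (F : R -> R)
    (a : I -> R) (s : nat) :
  F 0 = 0 -> (forall x y, 0 <= x -> x < y -> F x < F y) ->
  (forall x y, 0 <= x -> x <= y -> x * F y <= y * F x) ->
  (forall i, 0 <= a i) ->
  (forall S : {set I}, (#|S| <= s)%N ->
     \sum_(i in S) a i < \sum_(j in ~: S) a j) ->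
  forall S : {set I}, (#|S| <= s)%N ->
     \sum_(i in S) F (a i) < \sum_(j in ~: S) F (a j).
Proof.
move=> F0 incF starF a0 alt S Ss.
case: (arg_maxP (P := [pred T : {set I} | (#|T| <= s)%N])
  (fun T => \sum_(i in T) F (a i)) Ss) => T /= Ts Tmax.
have TC (U : {set I}) :
    \sum_(i in ~: U) F (a i) = \sum_i F (a i) - \sum_(i in U) F (a i).
  rewrite [X in _ = X - _](bigID [in U])/= addrAC subrr add0r.
  by apply: eq_bigl => i; rewrite inE.
(* Passing from [T] to [S] does not increase the inner sum, hence does not decrease the
   complementary one. *)
suff : \sum_(i in T) F (a i) < \sum_(j in ~: T) F (a j).
  by have := Tmax S Ss; rewrite !TC; lra.
(* Otherwise replacing [i] by [j] in [T] keeps the cardinality and strictly increases the sum of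
   [F], against maximality. *)
have exchange i j : i \in T -> j \in ~: T -> a j <= a i.
  rewrite inE => iT jT; rewrite leNgt; apply/negP => aij.
  have jTi : j \notin T :\ i by rewrite inE negb_and jT orbT.
  have cardT := cardsD1 i T; rewrite iT in cardT.
  have := Tmax (j |: (T :\ i)); rewrite cardsU1 jTi -cardT => /(_ Ts).
  rewrite big_setU1//= (big_setD1 i iT)/= lerD2r leNgt.
  by rewrite incF.
(* The default [0] is harmless since [a] is nonnegative. *)
pose M := \big[Order.max/0]_(j in ~: T) a j.
have aM : {in ~: T, forall j, a j <= M}.
  by move=> j jT; exact: (le_bigmax_cond _ a).
(* If [M <= 0], the sum off [T] is at most [0], so it cannot exceed the nonnegative sum over [T]. *)
have M0 : 0 < M.
  rewrite ltNge; apply/negP => M0; have := alt T Ts; apply/negP.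
  rewrite -leNgt (@le_trans _ _ 0)// ?sumr_ge0//.
  by apply: sumr_le0 => j jT; rewrite (le_trans (aM j jT)).
apply: (@threshold_sum_lt _ _ _ _ _ M) => //.
- by rewrite -F0 incF.
- by move=> i iT; apply: bigmax_le => // j; exact: exchange.
- exact: alt.
Qed.

Theorem theorem2 (R : realType) (p sigma : R) (N s : nat)
    (hp : 0 < p) (hsigma : 0 < sigma) (hN : (1 < N)%N)
    (hs1 : (1 <= s)%N) (hs : s%:R < N%:R / 2 :> R) :
  [set v : 'cV[R]_N | forall S : {set 'I_N}, (#|S| <= s)%N ->
      l1norm (restr S v) < l1norm (restr (~: S) v)]
  `<=`
  [set v : 'cV[R]_N | forall S : {set 'I_N}, (#|S| <= s)%N ->
      J p sigma (restr S v) < J p sigma (restr (~: S) v)]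
  /\
  (forall (m : nat) (A : 'M[R]_(m, N)),
      null_space_property s A ->
      generalized_null_space_property p sigma s A).
Proof.
set l1set := (X in X `<=` _); set Jset := (X in _ `<=` X).
have l1J : l1set `<=` Jset.
  move=> v vl1 S Ss; rewrite /J !sum_restr ?Phi0//.
  apply: (sum_lt_setC_star_shaped (a := fun j => `|v j 0|) _ _ _ _ _ Ss) => //.
  - exact: Phi0.
  - by move=> x y; exact: ltr_Phi.
  - by move=> x y; exact: Phi_star_shaped.
  - by move=> U /vl1; rewrite /l1norm !(sum_restr (f := id)).
(* The null space property places every nonzero kernel vector in [l1set]. *)
by split=> // m A nsp v /nsp vl1; exact: l1J.
Qed.
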